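(* Every complex $3$-dimensional power-associative nilalgebra that is not anticommutative is solvable.
   Context: An algebra is a complex vector space with a bilinear multiplication, not necessarily associative. An element $x$ is nil if there is $n$ such that for each $k\ge n$ every non-associative product of $k$ copies of $x$ (all arrangements of brackets) is zero; an algebra is a nilalgebra if each of its elements is nil. An algebra is power-associative if every subalgebra generated by one element is associative. An algebra is anticommutative if $x^2=0$ for all $x$ (equivalently $xy=-yx$ for all $x,y$). An algebra $\mathrm{A}$ is solvable if the series $\mathrm{A}^{(0)}=\mathrm{A}$, $\mathrm{A}^{(i+1)}=\mathrm{A}^{(i)}\mathrm{A}^{(i)}$ (linear span of products) reaches $0$. *)

(* Defs.v *)
From HB Require Import structures.
From mathcomp Require Import all_boot all_order all_algebra.
From mathcomp Require Import reals complex.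

Set Implicit Arguments.
Unset Strict Implicit.
Unset Printing Implicit Defensive.

Import GRing.Theory.
Local Open Scope ring_scope.

(* MathComp's algebra structures (lalgType, falgType) are associative and
   unital, so an algebra is here a finite-dimensional vector space together
   with an arbitrary bilinear map. *)

Inductive bracketing : Type :=
| Leaf
| Node of bracketing & bracketing.

Fixpoint leaves (t : bracketing) : nat :=
  if t is Node l r then (leaves l + leaves r)%N else 1%N.

Section NonassociativeAlgebra.

Variables (F : fieldType) (A : vectType F) (mul : {bilinear A -> A -> A}).

Fixpoint bracket_eval (x : A) (t : bracketing) : A :=
  if t is Node l r then mul (bracket_eval x l) (bracket_eval x r) else x.

Definition nil_element (x : A) : Prop :=
  exists n : nat, forall k : nat, (n <= k)%N ->
    forall t : bracketing, leaves t = k -> bracket_eval x t = 0.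

Definition nilalgebra : Prop := forall x : A, nil_element x.

Definition anticommutative : Prop := forall x : A, mul x x = 0.

Definition is_subalgebra (U : {vspace A}) : Prop :=
  forall u v : A, u \in U -> v \in U -> mul u v \in U.

(* Membership in the intersection of all subalgebras containing x; every
   linear subspace of A is a {vspace A} because A is finite-dimensional. *)
Definition in_generated_subalgebra (x y : A) : Prop :=
  forall U : {vspace A}, is_subalgebra U -> x \in U -> y \in U.

Definition power_associative : Prop :=
  forall x a b c : A,
    in_generated_subalgebra x a -> in_generated_subalgebra x b ->
    in_generated_subalgebra x c ->
    mul (mul a b) c = mul a (mul b c).

(* As in the library's prodv for associative algebras, the span is taken over
   products of basis vectors; prodspaceP shows that this is the linear span of
   all products. *)
Definition prodspace (U V : {vspace A}) : {vspace A} :=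
  <<[seq mul u v | u <- vbasis U, v <- vbasis V]>>%VS.

Lemma mem_prodspace (U V : {vspace A}) (u v : A) :
  u \in U -> v \in V -> mul u v \in prodspace U V.
Proof.
move=> /coord_vbasis -> /coord_vbasis ->.
rewrite linear_sumlz /=; apply: memv_suml => i _.
rewrite linear_sumr /=; apply: memv_suml => j _.
rewrite linearZl_LR linearZr_LR /= !memvZ // memv_span //.
by apply: allpairs_f; apply: mem_nth; rewrite size_tuple.
Qed.

Lemma prodspaceP (U V W : {vspace A}) :
  (forall u v : A, u \in U -> v \in V -> mul u v \in W) <->
  (prodspace U V <= W)%VS.
Proof.
split=> [sW | /subvP sW u v Uu Vv]; last exact/sW/mem_prodspace.
apply/span_subvP=> _ /allpairsP[[u v] /= [Uu Vv ->]].
by apply: sW; apply: vbasis_mem.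
Qed.

Fixpoint derived_series (i : nat) : {vspace A} :=
  if i is j.+1 then prodspace (derived_series j) (derived_series j)
  else fullv.

Definition solvable_algebra : Prop :=
  exists i : nat, derived_series i = 0%VS.

End NonassociativeAlgebra.

(* Main.v *)
Require Import Defs.
From HB Require Import structures.
From mathcomp Require Import all_boot all_order all_algebra.
From mathcomp Require Import ring boolp.
From mathcomp Require Import reals complex.

Set Implicit Arguments.
Unset Strict Implicit.
Unset Printing Implicit Defensive.

Import GRing.Theory.
Local Open Scope ring_scope.

(** The proof turns on whether some cube [x (x x)] is nonzero.

    In dimension 3, a vector killed by some iterate of an endomorphism is killed
    by the third one ([nilpotent_iter_dim]). Taking left multiplication by [x]
    and the vector [x], this shows that all fourth powers vanish.

    If some cube is nonzero, then [x], [x^2], [x^3] form a basis, so the algebra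
    is generated by [x]: it is associative, and products of two products are
    fourth or higher powers, hence zero ([solvable_of_basis_of_powers]).

    If all cubes vanish, choose [x] with [f = x^2] nonzero, and complete
    [x], [f] to a basis with some [y]. Linearizing the identities [v v^2 = 0],
    [v^2 v = 0] and [v^2 v^2 = 0] along the line [x + k y] gives relations
    between [f], [s = x y + y x] and [w = y^2]. Writing
    [s = a x + b f + c y] and [w = p x + q f + r y], these relations force
    successively [c = 0], [a = 0], [r = 0] and [p = 0]
    ([cube_zero_structure]). So [f] annihilates the algebra and all squares lie
    on the line of [f]; the quotient by that line is anticommutative of
    dimension 2. The derived series therefore goes down through the span of [f]
    and [x y], then the line of [f], then [0]
    ([solvable_of_squares_in_annihilator]). *)

(** * Bases and nilpotent orbits in a vector space *)

Section VectorSpaces.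

Variables (F : fieldType) (V : vectType F).
Implicit Types a b c u v : V.

(** Turns an identity between linear combinations into polynomial identities
    over the field, where [ring] and [field] apply. *)
Lemma eq_coord_fullv u v :
  (forall i, coord (vbasis {:V}) i u = coord (vbasis {:V}) i v) -> u = v.
Proof.
move=> eq_uv; rewrite (coord_vbasis (memvf u)) (coord_vbasis (memvf v)).
by apply: eq_bigr => i _; rewrite eq_uv.
Qed.

Lemma scale_regE (k x : F) : k *: (x : F^o) = k * x.
Proof. by []. Qed.

Lemma memv_span3P a b c v :
  reflect (exists k1 k2 k3, v = k1 *: a + k2 *: b + k3 *: c)
          (v \in <<[:: a; b; c]>>%VS).
Proof.
rewrite !span_cons span_nil addv0.
apply: (iffP idP) => [/memv_addP[_ /vlineP[k1 ->] [u]]|[k1 [k2 [k3 ->]]]].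
  case/memv_addP=> _ /vlineP[k2 ->] [_ /vlineP[k3 ->] ->] ->.
  by exists k1, k2, k3; rewrite addrA.
by rewrite -addrA !memv_add // memvZ // memv_line.
Qed.

Lemma free3_coef a b c k1 k2 k3 : free [:: a; b; c] ->
  k1 *: a + k2 *: b + k3 *: c = 0 -> [/\ k1 = 0, k2 = 0 & k3 = 0].
Proof.
move=> /(@freeP _ _ _ [tuple a; b; c]) free_abc k0.
pose k (i : 'I_3) := nth 0 [:: k1; k2; k3] i.
have /free_abc k_eq0 : \sum_(i < 3) k i *: [:: a; b; c]`_i = 0.
  by rewrite 3!big_ord_recl big_ord0 /= addr0 addrA.
by split; [apply: (k_eq0 0)|apply: (k_eq0 1)|apply: (k_eq0 2%:R)].
Qed.

Lemma free3_full a b c : \dim {:V} = 3%N -> free [:: a; b; c] ->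
  forall v, exists k1 k2 k3, v = k1 *: a + k2 *: b + k3 *: c.
Proof.
move=> dimV free_abc v; apply/memv_span3P.
suff /eqP-> : <<[:: a; b; c]>>%VS == fullv by apply: memvf.
by rewrite eqEdim subvf dimV (eqP free_abc).
Qed.

Lemma free2_extend a b : (2 < \dim {:V})%N -> free [:: a; b] ->
  exists c, free [:: a; b; c].
Proof.
move=> dimV free_ab.
have /subvPn[c _ ab'c] : ~~ (fullv <= <<[:: a; b]>>)%VS.
  by apply/negP=> /dimvS; rewrite (eqP free_ab) leqNgt dimV.
exists c; have /perm_free -> : perm_eq [:: a; b; c] [:: c; a; b].
  exact: permEl (perm_catC [:: a; b] [:: c]).
by rewrite free_cons ab'c.
Qed.

(** All vectors of the orbit but the first one are killed by [T ^ k], which does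
    not kill [v]; so [v] is independent of the others, and these form a shorter
    orbit of the same kind, starting from [T v]. *)
Lemma free_iter (T : {linear V -> V}) k v :
  iter k T v != 0 -> iter k.+1 T v = 0 ->
  free [seq iter i T v | i <- iota 0 k.+1].
Proof.
elim: k v => [|k IHk] v nz_k k1_0; first by rewrite seq1_free.
have tailE : [seq iter i T v | i <- iota 1 k.+1]
           = [seq iter i T (T v) | i <- iota 0 k.+1].
  by rewrite (iotaDl 1 0) -map_comp; apply: eq_map => i /=; rewrite -iterSr.
rewrite -[iota 0 _]/(0%N :: iota 1 k.+1) map_cons tailE free_cons.
rewrite IHk -?iterSr // andbT; apply: contra nz_k => tail_v.
have iter0 m : iter m T 0 = 0 by elim: m => //= m ->; rewrite linear0.
have iterL m : linear (iter m T).
  by elim: m => [|m IHm] c u w //=; rewrite IHm linearP.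
pose TkM := GRing.isLinear.Build F V V *:%R (iter k.+1 T) (iterL k.+1).
pose Tk : {linear V -> V} := HB.pack (iter k.+1 T) TkM.
have: (<<[seq iter i T (T v) | i <- iota 0 k.+1]>> <= lker (linfun Tk))%VS.
  apply/span_subvP=> _ /mapP[i _ ->].
  rewrite memv_ker lfunE /= -/(iter k.+1 T _).
  by rewrite -iterD addnC iterD -iterSr k1_0 iter0.
by move/subvP/(_ v tail_v); rewrite memv_ker lfunE.
Qed.

(** The nonzero part of the orbit of [v] is free, hence no longer than the
    dimension. *)
Lemma nilpotent_iter_dim (T : {linear V -> V}) n v :
  iter n T v = 0 -> iter (\dim {:V}) T v = 0.
Proof.
move=> Tn0; have iter0 m : iter m T 0 = 0.
  by elim: m => //= m ->; rewrite linear0.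
have ex0 : exists m, iter m T v == 0 by exists n; apply/eqP.
case: (ex_minnP ex0) => m /eqP Tm0 min_m.
have [le_m|lt_m] := leqP m (\dim {:V}).
  by rewrite -(subnK le_m) iterD Tm0 iter0.
case: m => [//|m] in Tm0 min_m lt_m *.
have nzm : iter m T v != 0 by apply/negP=> /min_m; rewrite ltnn.
have := dimvS (subvf <<[seq iter i T v | i <- iota 0 m.+1]>>).
by rewrite (eqP (free_iter nzm Tm0)) size_map size_iota leqNgt lt_m.
Qed.

End VectorSpaces.

Ltac to_coordinates := apply: eq_coord_fullv => ?;
  rewrite ?(linearD, linearN, linearZ, linear0) /= ?scale_regE.

Ltac vring := to_coordinates; ring.

(** * Linearization of power identities *)

Section Algebras.

Variables (F : numFieldType) (A : vectType F) (mul : {bilinear A -> A -> A}).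
Implicit Types u v w x y z : A.

Local Notation "u ** v" := (mul u v) (at level 40, left associativity).

Let mulDl u v w : (u + v) ** w = u ** w + v ** w.
Proof. exact: linearDl. Qed.
Let mulDr u v w : u ** (v + w) = u ** v + u ** w.
Proof. exact: linearDr. Qed.
Let mulZl k u v : (k *: u) ** v = k *: (u ** v).
Proof. exact: linearZl_LR. Qed.
Let mulZr k u v : u ** (k *: v) = k *: (u ** v).
Proof. exact: linearZr_LR. Qed.
Let mulE := (mulDl, mulDr, mulZl, mulZr).

(** Values at [1], [-1] and [2] determine a cubic polynomial with zero constant
    term; solving that system inverts [2] and [3]. *)
Lemma cubic_coef_eq0 u v w :
  (forall k : F, k *: u + k ^+ 2 *: v + k ^+ 3 *: w = 0) ->
  [/\ u = 0, v = 0 & w = 0].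
Proof.
move=> P0; have := P0 1; have := P0 (-1); have := P0 2%:R.
set e2 := (_ + _ + _) => e2_0; set e_1 := (_ + _ + _) => e_1_0.
set e1 := (_ + _ + _) => e1_0.
split.
- have -> : u = e1 - 3%:R^-1 *: e_1 - 6%:R^-1 *: e2.
    by rewrite /e1 /e_1 /e2; to_coordinates; field.
  by rewrite e1_0 e_1_0 e2_0 !scaler0 !subr0.
- have -> : v = 2%:R^-1 *: e1 + 2%:R^-1 *: e_1.
    by rewrite /e1 /e_1 /e2; to_coordinates; field.
  by rewrite e1_0 e_1_0 !scaler0 addr0.
- have -> : w = 6%:R^-1 *: e2 - 2%:R^-1 *: e1 - 6%:R^-1 *: e_1.
    by rewrite /e1 /e_1 /e2; to_coordinates; field.
  by rewrite e1_0 e_1_0 e2_0 !scaler0 !subr0.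
Qed.

(** This is the coefficient of [k] in the cube of [x + k y]. *)
Lemma cube_r_linearized :
  (forall v, v ** (v ** v) = 0) ->
  forall x y, x ** (x ** y + y ** x) + y ** (x ** x) = 0.
Proof.
move=> cube0 x y.
pose u := x ** (x ** y + y ** x) + y ** (x ** x).
pose v := y ** (x ** y + y ** x) + x ** (y ** y).
suff [] : [/\ u = 0, v = 0 & y ** (y ** y) = 0] by [].
apply: cubic_coef_eq0 => k.
transitivity ((x + k *: y) ** ((x + k *: y) ** (x + k *: y)) - x ** (x ** x)).
  by rewrite /u /v !mulE; vring.
by rewrite !cube0 subr0.
Qed.

Lemma cube_l_linearized :
  (forall v, (v ** v) ** v = 0) ->
  forall x y, (x ** y + y ** x) ** x + (x ** x) ** y = 0.
Proof.
move=> cube0 x y.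
pose u := (x ** y + y ** x) ** x + (x ** x) ** y.
pose v := (x ** y + y ** x) ** y + (y ** y) ** x.
suff [] : [/\ u = 0, v = 0 & (y ** y) ** y = 0] by [].
apply: cubic_coef_eq0 => k.
transitivity (((x + k *: y) ** (x + k *: y)) ** (x + k *: y) - (x ** x) ** x).
  by rewrite /u /v !mulE; vring.
by rewrite !cube0 subr0.
Qed.

(** With [s = x y + y x], the square of [x + k y] is [x^2 + k s + k^2 y^2]; the
    three equations are the middle coefficients of the square of that. *)
Lemma square_square_linearized :
  (forall v, (v ** v) ** (v ** v) = 0) ->
  forall x y, let s := x ** y + y ** x in
  [/\ (x ** x) ** s + s ** (x ** x) = 0,
      (x ** x) ** (y ** y) + (y ** y) ** (x ** x) + s ** s = 0
    & s ** (y ** y) + (y ** y) ** s = 0].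
Proof.
move=> sq_sq0 x y s; apply: cubic_coef_eq0 => k.
transitivity (((x + k *: y) ** (x + k *: y)) ** ((x + k *: y) ** (x + k *: y))
  - (x ** x) ** (x ** x) - k ^+ 4 *: ((y ** y) ** (y ** y))).
  by rewrite /s !mulE; vring.
by rewrite !sq_sq0 scaler0 !subr0.
Qed.

(** * The structure of the algebra when all cubes vanish *)

(** Coordinates of [x y + y x] and [y y] are shown to vanish one at a time.
    The multipliers in the combinations of linearized identities are chosen to
    avoid any division, so that three of the coordinates first appear through
    their cubes. *)
Lemma cube_zero_structure x y :
  \dim {:A} = 3%N ->
  (forall v, v ** (v ** v) = 0) -> (forall v, (v ** v) ** v = 0) ->
  (forall v, (v ** v) ** (v ** v) = 0) ->
  free [:: x; x ** x; y] ->
  [/\ y ** (x ** x) = 0, (x ** x) ** y = 0,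
      x ** y + y ** x \in <[x ** x]>%VS & y ** y \in <[x ** x]>%VS].
Proof.
move=> dimA cube_r cube_l sq_sq free_xfy.
have [fs fw_ss sw] := square_square_linearized sq_sq x y.
have xs_yf := cube_r_linearized cube_r x y.
have sx_fy := cube_l_linearized cube_l x y.
have ys_xw := cube_r_linearized cube_r y x.
have sy_wx := cube_l_linearized cube_l y x.
rewrite ![y ** x + _]addrC in ys_xw sy_wx.
have [[xf fx] ff] := (cube_r x, cube_l x, sq_sq x).
have [yw wy] := (cube_r y, cube_l y).
have coef0 := free3_coef free_xfy.
have nz_f : x ** x != 0.
  apply/eqP=> f0; have [] := coef0 0 1 0.
    by rewrite f0 !scale0r scaler0 !addr0.
  by move=> _ /eqP; rewrite oner_eq0.
have [a [b [c sE]]] := free3_full dimA free_xfy (x ** y + y ** x).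
have [p [q [r wE]]] := free3_full dimA free_xfy (y ** y).
move: fs fw_ss sw xs_yf sx_fy ys_xw sy_wx; rewrite /= sE wE.
move: xf fx ff yw wy coef0 nz_f sE wE; rewrite /=.
move Df : (x ** x) => f; move Dw : (y ** y) => w.
move=> xf fx ff yw wy coef0 nz_f sE wE.
have simpE := (mulE, Df, Dw, xf, fx, ff, scaler0, addr0, add0r).
have scale_f_eq0 k : k *: f = 0 -> k = 0.
  by move/eqP; rewrite scaler_eq0 (negPf nz_f) orbF => /eqP.
rewrite !simpE => fs fw_ss sw xs_yf sx_fy ys_xw sy_wx.
(* Put [s = x y + y x]. Adding the linearized cubes gives
   [f y + y f = - (2 a f + c s)], while [f s + s f = 0] reads
   [c (f y + y f) = 0]; so [c (2 a f + c s) = 0], whose coordinate on [y] is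
   [c ^ 3]. *)
have c0 : c = 0.
  have [] := coef0 (c ^+ 2 * a) (2%:R * a * c + c ^+ 2 * b) (c ^+ 3).
    have -> : (c ^+ 2 * a) *: x + (2%:R * a * c + c ^+ 2 * b) *: f + c ^+ 3 *: y
        = c *: ((a *: f + c *: (x ** y) + y ** f)
                + (a *: f + c *: (y ** x) + f ** y))
          - (c *: (f ** y) + c *: (y ** f))
          + c ^+ 2 *: (a *: x + b *: f + c *: y - (x ** y + y ** x)) by vring.
    by rewrite xs_yf sx_fy fs sE subrr addr0 !scaler0 subr0 addr0.
  by move=> _ _ /eqP; rewrite expf_eq0 => /eqP.
have fyE : f ** y = - a *: f.
  have -> : f ** y = (a *: f + c *: (y ** x) + f ** y)
      - a *: f - c *: (y ** x) by vring.
  by rewrite sx_fy c0 scale0r sub0r subr0 scaleNr.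
have yfE : y ** f = - a *: f.
  have -> : y ** f = (a *: f + c *: (x ** y) + y ** f)
      - a *: f - c *: (x ** y) by vring.
  by rewrite xs_yf c0 scale0r sub0r subr0 scaleNr.
rewrite {c fs xs_yf sx_fy}c0 !fyE !yfE !(scale0r, scaler0, addr0)
  in sE fw_ss sw ys_xw sy_wx *.
(* The coordinate of [s w + w s] on [x] is [a ^ 2 r], and
   [f w + w f + s s = (a ^ 2 - 2 r a) f]; together these give [a ^ 3 = 0]. *)
have a0 : a = 0.
  have [] := coef0 (a ^+ 2 * r) (2%:R * a * p - a * b * r) 0.
    rewrite -[RHS]sw.
    have -> : y ** x = a *: x + b *: f - x ** y by rewrite -sE; vring.
    by vring.
  move=> a2r0 _ _.
  have /scale_f_eq0 a2_2ra : (a ^+ 2 - 2%:R * r * a) *: f = 0.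
    by rewrite -[RHS]fw_ss; vring.
  have /eqP : a ^+ 3 = 0.
    have -> : a ^+ 3 = a * (a ^+ 2 - 2%:R * r * a) + 2%:R * (a ^+ 2 * r).
      by ring.
    by rewrite a2_2ra a2r0 !mulr0 addr0.
  by rewrite expf_eq0 => /eqP.
rewrite {a fw_ss sw}a0 oppr0 !(scale0r, scaler0, addr0, add0r)
  in sE fyE yfE ys_xw sy_wx *.
(* From [y w = 0] and [w x + s y = 0] one gets [p (y x) + r w = 0] and
   [p f + r (y x) = 0]; eliminating [y x] leaves [r ^ 2 w = p ^ 2 f], whose
   coordinate on [y] is [r ^ 3]. *)
have r0 : r = 0.
  have [] := coef0 (r ^+ 2 * p) (r ^+ 2 * q - p ^+ 2) (r ^+ 3).
    have ywx : p *: (y ** x) + r *: w = 0.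
      by move: yw; rewrite {1}wE !mulE yfE Dw scaler0 addr0.
    have -> : (r ^+ 2 * p) *: x + (r ^+ 2 * q - p ^+ 2) *: f + r ^+ 3 *: y
        = r *: (p *: (y ** x) + r *: w) - p *: (p *: f + r *: (y ** x)).
      by rewrite wE; vring.
    by rewrite ywx sy_wx !scaler0 subr0.
  by move=> _ _ /eqP; rewrite expf_eq0 => /eqP.
have p0 : p = 0 by apply: scale_f_eq0; move: sy_wx; rewrite r0 scale0r addr0.
rewrite p0 r0 !scale0r add0r addr0; split; rewrite ?memvZ ?memv_line //.
Qed.

(** * Solvability *)

Lemma derived_seriesS_sub i (U W : {vspace A}) :
  (derived_series mul i <= U)%VS ->
  (forall u v, u \in U -> v \in U -> u ** v \in W) ->
  (derived_series mul i.+1 <= W)%VS.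
Proof.
move=> /subvP sU UW; apply/prodspaceP => u v /sU Uu /sU Uv; exact: UW.
Qed.

(** Modulo the line of [f = x x] the product is alternating on the plane
    spanned by [x] and [y], so all products lie in the span of [f] and [x y].
    Two elements of that span multiply to a multiple of the square of [x y],
    which is on the line of [f]. *)
Lemma solvable_of_squares_in_annihilator x y :
  (forall v, exists a b c, v = a *: x + b *: (x ** x) + c *: y) ->
  (forall v, (x ** x) ** v = 0) -> (forall v, v ** (x ** x) = 0) ->
  (forall v, v ** v \in <[x ** x]>%VS) ->
  solvable_algebra mul.
Proof.
move Df: (x ** x) => f gen fl fr sq.
have yx_f : x ** y + y ** x \in <[f]>%VS.
  have -> : x ** y + y ** x = (x + y) ** (x + y) - x ** x - y ** y.
    by rewrite !mulE; vring.
  by rewrite !rpredB.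
have D1 : (derived_series mul 1 <= <[f]> + <[x ** y]>)%VS.
  apply: (@derived_seriesS_sub 0 fullv) => // u v _ _.
  have [[a [b [c ->]]] [a' [b' [c' ->]]]] := (gen u, gen v).
  rewrite !mulE !fl !fr !scaler0 !(addr0, add0r) Df.
  rewrite [X in X \in _](_ : _ = ((a * a') *: f + (a' * c) *: (x ** y + y ** x)
    + (c * c') *: (y ** y)) + (a * c' - a' * c) *: (x ** y)); last by vring.
  by rewrite memv_add // ?rpredD ?rpredZ ?memv_line.
have D2 : (derived_series mul 2 <= <[f]>)%VS.
  apply: (derived_seriesS_sub D1) => u v.
  case/memv_addP=> _ /vlineP[b ->] [_ /vlineP[k ->] ->].
  case/memv_addP=> _ /vlineP[b' ->] [_ /vlineP[k' ->] ->].
  by rewrite !mulE !fl !fr !scaler0 !add0r !rpredZ.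
exists 3%N; apply/eqP; rewrite -subv0.
by apply: (derived_seriesS_sub D2) => _ v /vlineP[b ->] _;
  rewrite mulZl fl scaler0 mem0v.
Qed.

Lemma generated_self x : in_generated_subalgebra mul x x.
Proof. by []. Qed.

Lemma generated_mul x u v :
  in_generated_subalgebra mul x u -> in_generated_subalgebra mul x v ->
  in_generated_subalgebra mul x (u ** v).
Proof. by move=> gu gv U sU Ux; apply: (sU); [apply: gu | apply: gv]. Qed.

(** Power-associativity rewrites every product of powers of [x] as an iterated
    left multiplication by [x], so products of at least four factors vanish. *)
Lemma solvable_of_basis_of_powers x :
  power_associative mul -> x ** (x ** (x ** x)) = 0 ->
  (forall v, exists a b c, v = a *: x + b *: (x ** x) + c *: (x ** (x ** x))) ->
  solvable_algebra mul.
Proof.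
move=> assoc x4 gen.
have gx := @generated_self x.
have g2 := generated_mul gx gx; have g3 := generated_mul gx g2.
have f_assoc v : in_generated_subalgebra mul x v ->
    (x ** x) ** v = x ** (x ** v).
  by move=> gv; exact: (assoc _ _ _ _ gx gx gv).
have g_assoc v : in_generated_subalgebra mul x v ->
    (x ** (x ** x)) ** v = x ** (x ** (x ** v)).
  by move=> gv; rewrite (assoc _ _ _ _ gx g2 gv) f_assoc.
have prodE := (f_assoc _ gx, f_assoc _ g2, f_assoc _ g3,
  g_assoc _ gx, g_assoc _ g2, g_assoc _ g3,
  x4, linear0r, scaler0, addr0, add0r).
have D1 : (derived_series mul 1 <= <[x ** x]> + <[x ** (x ** x)]>)%VS.
  apply: (@derived_seriesS_sub 0 fullv) => // u v _ _.
  have [[a [b [c ->]]] [a' [b' [c' ->]]]] := (gen u, gen v).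
  rewrite !mulE !prodE [X in X \in _](_ : _ = (a * a') *: (x ** x)
    + (a * b' + b * a') *: (x ** (x ** x))); last by vring.
  by rewrite memv_add // rpredZ // memv_line.
exists 2%N; apply/eqP; rewrite -subv0.
apply: (derived_seriesS_sub D1) => u v.
case/memv_addP=> _ /vlineP[b ->] [_ /vlineP[c ->] ->].
case/memv_addP=> _ /vlineP[b' ->] [_ /vlineP[c' ->] ->].
by rewrite !mulE !prodE mem0v.
Qed.

(** The iterates are the values of the right combs [x (x (.. x))]. *)
Lemma nil_iter_mul x : nil_element mul x -> exists n, iter n (mul x) x = 0.
Proof.
case=> n nil_x; exists n.
have leaves_t m : leaves (iter m (Node Leaf) Leaf) = m.+1.
  by elim: m => //= m ->.
have eval_t m : bracket_eval mul x (iter m (Node Leaf) Leaf) = iter m (mul x) x.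
  by elim: m => //= m ->.
by rewrite -eval_t; apply: (nil_x n.+1) => //; apply: leaves_t.
Qed.

Theorem dim3_nil_power_associative_solvable :
  \dim {:A} = 3%N -> power_associative mul -> nilalgebra mul ->
  ~ anticommutative mul -> solvable_algebra mul.
Proof.
move=> dimA assoc nilA /existsNP[x /eqP nz_xx].
have pow4 v : v ** (v ** (v ** v)) = 0.
  have [n vn0] := nil_iter_mul (nilA v).
  by have := nilpotent_iter_dim vn0; rewrite dimA.
have assoc1 v : (v ** v) ** v = v ** (v ** v) by apply: (assoc v).
have sq_sq v : (v ** v) ** (v ** v) = 0.
  have g1 := @generated_self v; have g2 := generated_mul g1 g1.
  by rewrite (assoc _ _ _ _ g1 g1 g2) pow4.
have [[z /eqP z3]|/forallNP cube0] := pselect (exists z, z ** (z ** z) <> 0).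
  apply: (@solvable_of_basis_of_powers z) => //; apply: free3_full => //.
  exact: (@free_iter _ _ (mul z) 2 z z3 (pow4 z)).
have cube_r v : v ** (v ** v) = 0 by apply: contra_notP (cube0 v).
have cube_l v : (v ** v) ** v = 0 by rewrite assoc1.
have free_xf : free [:: x; x ** x].
  exact: (@free_iter _ _ (mul x) 1 x nz_xx (cube_r x)).
have [y free_xfy] : exists y, free [:: x; x ** x; y].
  by apply: free2_extend; rewrite ?dimA.
have gen := free3_full dimA free_xfy.
have [yf fy xy_f yy_f] := cube_zero_structure dimA cube_r cube_l sq_sq free_xfy.
have fl v : (x ** x) ** v = 0.
  have [a [b [c ->]]] := gen v.
  by rewrite !mulE cube_l sq_sq fy !scaler0 !addr0.
have fr v : v ** (x ** x) = 0.
  have [a [b [c ->]]] := gen v.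
  by rewrite !mulE cube_r sq_sq yf !scaler0 !addr0.
apply: (solvable_of_squares_in_annihilator gen) => // v.
have [a [b [c ->]]] := gen v; rewrite !mulE !fl !fr !scaler0 !(addr0, add0r).
rewrite [X in X \in _](_ : _ = (a * a) *: (x ** x)
  + (a * c) *: (x ** y + y ** x) + (c * c) *: (y ** y)); last by vring.
by rewrite !rpredD ?rpredZ ?memv_line.
Qed.

End Algebras.

Theorem corollary8 (R : realType) (A : vectType R[i])
    (mul : {bilinear A -> A -> A}) :
  \dim {:A} = 3%N ->
  power_associative mul ->
  nilalgebra mul ->
  ~ anticommutative mul ->
  solvable_algebra mul.
Proof. exact: dim3_nil_power_associative_solvable. Qed.
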